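(* Let $\Gamma=(H,\sigma)$ be a signed hypergraph with underlying hypergraph $H=(V,E)$, $V=\{1,\dots,n\}$, and let $L$ be its normalized Laplacian with eigenvalues $\lambda_1\le\lambda_2\le\cdots\le\lambda_n$ (listed with multiplicity). Let $k\in\{1,\dots,n\}$ and let $f_k:V\to\mathbb{R}$ be any eigenfunction with $Lf_k=\lambda_k f_k$. Then $$\mathfrak{S}(f_k)\le k+r-1\qquad\text{and}\qquad \mathfrak{W}(f_k)\le k+c-1,$$ where $r$ is the multiplicity of $\lambda_k$ and $c$ is the number of connected components of $H$. In particular, if $H$ is connected, then $\mathfrak{W}(f_k)\le k$.
   Context: A (simple) signed hypergraph $\Gamma=(H,\sigma)$ consists of a finite hypergraph $H=(V,E)$ (each edge $e\in E$ a nonempty subset of $V$) together with a sign $\sigma(v,e)\in\{+1,-1\}$ for every incidence $v\in e\in E$. The sign of an edge $e$ with $|e|=l$ is $\mathrm{sgn}(e)=(-1)^{l-1}\prod_{v\in e}\sigma(v,e)$. $\deg(i)$ is the number of edges containing $i$; every vertex is assumed to have positive degree. The adjacency matrix is $A_{ij}=\sum_{e\in E:\, i,j\in e}\mathrm{sgn}(e)$ for $i\ne j$, $A_{ii}=0$; $D=\mathrm{diag}(\deg(1),\dots,\deg(n))$; the normalized Laplacian is $L=I-D^{-1}A$, acting on functions $f:V\to\mathbb{R}$. It is self-adjoint for $\langle f,g\rangle=\sum_{i\in V}\deg(i)f(i)g(i)$, so its eigenvalues are real. A path in $H$ is a sequence $v_1,e_1,v_2,\dots,e_q,v_{q+1}$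 of distinct vertices and distinct edges with $v_r,v_{r+1}\in e_r$; connectedness and connected components of $H$ are defined via such paths. Nodal domains. For $f:V\to\mathbb{R}$ let $\Omega=\{v: f(v)\neq 0\}$. An S-path of $f$ is a sequence $x_1,\dots,x_\ell$ of vertices such that for each $j<\ell$ there is an edge $e$ with $x_j,x_{j+1}\in e$ and $f(x_j)\,\mathrm{sgn}(e)\,f(x_{j+1})>0$. A W-path of $f$ is a sequence $x_1,\dots,x_\ell$ of vertices, consecutive ones lying in common edges $e_t\ni x_t,x_{t+1}$, such that whenever $x_i,x_j$ ($i<j$) are consecutive nonzeros of $f$ along the sequence (i.e. $f(x_i)\ne0\ne f(x_j)$ and $f(x_t)=0$ for $i<t<j$), one has $f(x_i)\,\mathrm{sgn}(e_i)\cdots\mathrm{sgn}(e_{j-1})\,f(x_j)>0$. On $\Omega$ define $x R_S y$ (resp. $x R_W y$) iff $x=y$ or some S-path (resp. W-path) connects $x$ and $y$; these are equivalence relations. $\mathfrak{S}(f)$ is the number of $R_S$-classes (strong nodal domains) and $\mathfrak{W}(f)$ is the number of $R_W$-classes (weak nodal domains) of $f$. *)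

(* Defs.v *)
From HB Require Import structures.
From mathcomp Require Import all_boot all_order all_algebra.
From mathcomp Require Import boolp reals.
Set Implicit Arguments.
Unset Strict Implicit.
Unset Printing Implicit Defensive.
Import Order.TTheory GRing.Theory Num.Theory.
Local Open Scope ring_scope.

(* The values of [isign] off the incidences v \in e \in edges are irrelevant:
   nothing below reads them. *)
Record signed_hypergraph (n : nat) := SignedHypergraph {
  edges : {set {set 'I_n}};
  edges_nonempty : forall e, e \in edges -> e != set0;
  isign : 'I_n -> {set 'I_n} -> int;
  isignP : forall v e, e \in edges -> v \in e ->
    isign v e = 1 \/ isign v e = -1
}.

Definition sgn_edge n (G : signed_hypergraph n) (e : {set 'I_n}) : int :=
  (-1) ^+ (#|e| - 1) * \prod_(v in e) isign G v e.

Definition deg n (G : signed_hypergraph n) (i : 'I_n) : nat :=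
  #|[set e in edges G | i \in e]|.

Section Laplacian.
Variables (R : realType) (n : nat) (G : signed_hypergraph n).

Definition adj_mx : 'M[R]_n := \matrix_(i, j)
  if i == j then 0
  else \sum_(e in edges G | (i \in e) && (j \in e)) (sgn_edge G e)%:~R.

Definition deg_mx : 'M[R]_n := diag_mx (\row_i (deg G i)%:R).

Definition normalized_laplacian : 'M[R]_n := 1%:M - invmx deg_mx *m adj_mx.

End Laplacian.

(* Classes of r on D, for a Prop-valued r meant to be an equivalence. *)
Definition num_classes (T : finType) (D : {set T}) (r : T -> T -> Prop) : nat :=
  #|equivalence_partition (fun x y => `[< r x y >]) D|.

(* In the paths below, [l] is the number of steps; the vertices are x 0, ..., x l
   and the edges e 0, ..., e l.-1, with e t joining x t to x t.+1. *)

Definition path_connected n (G : signed_hypergraph n) (a b : 'I_n) : Prop :=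
  exists (l : nat) (x : nat -> 'I_n) (e : nat -> {set 'I_n}),
    [/\ x 0%N = a, x l = b,
        forall s t, (s <= l)%N -> (t <= l)%N -> x s = x t -> s = t,
        forall s t, (s < l)%N -> (t < l)%N -> e s = e t -> s = t
      & forall t, (t < l)%N ->
          [/\ e t \in edges G, x t \in e t & x t.+1 \in e t]].

Definition hconnected n (G : signed_hypergraph n) : Prop :=
  forall a b : 'I_n, path_connected G a b.

Definition num_components n (G : signed_hypergraph n) : nat :=
  num_classes [set: 'I_n] (path_connected G).

Section NodalDomains.
Variables (R : realType) (n : nat) (G : signed_hypergraph n) (f : 'cV[R]_n).

Definition nonzeros : {set 'I_n} := [set v | f v 0 != 0].

Definition S_path (l : nat) (x : nat -> 'I_n) : Prop :=
  forall j, (j < l)%N -> exists e : {set 'I_n},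
    [/\ e \in edges G, x j \in e, x j.+1 \in e
      & 0 < f (x j) 0 * (sgn_edge G e)%:~R * f (x j.+1) 0].

Definition W_path (l : nat) (x : nat -> 'I_n) (e : nat -> {set 'I_n}) : Prop :=
  (forall t, (t < l)%N ->
     [/\ e t \in edges G, x t \in e t & x t.+1 \in e t]) /\
  (forall i j, (i < j)%N -> (j <= l)%N ->
     f (x i) 0 != 0 -> f (x j) 0 != 0 ->
     (forall t, (i < t)%N -> (t < j)%N -> f (x t) 0 = 0) ->
     0 < f (x i) 0 * (\prod_(i <= t < j) (sgn_edge G (e t))%:~R) * f (x j) 0).

Definition R_S (a b : 'I_n) : Prop :=
  a = b \/ exists (l : nat) (x : nat -> 'I_n),
    [/\ x 0%N = a, x l = b & S_path l x].

Definition R_W (a b : 'I_n) : Prop :=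
  a = b \/ exists (l : nat) (x : nat -> 'I_n) (e : nat -> {set 'I_n}),
    [/\ x 0%N = a, x l = b & W_path l x e].

Definition num_strong_nodal : nat := num_classes nonzeros R_S.
Definition num_weak_nodal : nat := num_classes nonzeros R_W.

End NodalDomains.

(* Main.v *)
Require Import Defs.
From HB Require Import structures.
From mathcomp Require Import all_boot all_order all_algebra.
From mathcomp Require Import boolp reals.
From mathcomp Require Import spectral sesquilinear.
From mathcomp.real_closed Require Import complex.
From mathcomp Require Import zify ring.
Set Implicit Arguments.
Unset Strict Implicit.
Unset Printing Implicit Defensive.
Import Order.TTheory GRing.Theory Num.Theory.
Local Open Scope ring_scope.

(* Let M = D - A - lambda_k D, so that M f = 0.  For weights c that are constant
   on nodal domains, M f = 0 turns the quadratic form of M at c f into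
   1/2 sum_(x, y) (c x - c y)^2 f(x) A_xy f(y), which is <= 0 because every edge
   between two domains contributes a negative term.  By the spectral theorem, M
   kills a subspace of codimension <= k - 1 of the space of all these c f.  For
   strong domains, compare with dim ker M = r.  For weak domains, a c f killed
   by M has c constant on each connected component of H: across edges joining
   nonzeros because all terms of the form vanish, and across zeros of f because
   (M f) z = (M c f) z = 0 there; hence the space of such c has dimension <= c. *)

(** * Ranks of diagonal matrices and invariance of the characteristic polynomial *)

Lemma mxrank_diag_le (F : fieldType) n (d : 'rV[F]_n) :
  (\rank (diag_mx d) <= #|[pred i | d 0%R i != 0%R]|)%N.
Proof.
rewrite diag_mx_sum_delta (bigID [pred i | d 0 i != 0]) /= [X in _ + X]big1 ?addr0.
  rewrite -sum1_card; elim/big_ind2: _ => [|A a B b le_a le_b|i _].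
  - by rewrite mxrank0.
  - by rewrite (leq_trans (mxrank_add _ _)) ?leq_add.
  - by rewrite (leq_trans (mxrank_scale _ _)) // mxrank_delta.
by move=> i /negPn/eqP->; rewrite scale0r.
Qed.

Lemma corank_diag (F : fieldType) n (d : 'rV[F]_n) :
  (n <= \rank (diag_mx d) + #|[pred i | d 0%R i == 0%R]|)%N.
Proof.
pose e : 'rV[F]_n := \row_i (d 0 i == 0)%:R.
have -> : #|[pred i | d 0 i == 0]| = #|[pred i | e 0 i != 0]|.
  by apply: eq_card => i; rewrite !inE mxE; case: eqP; rewrite ?oner_neq0 ?eqxx.
rewrite -[X in (X <= _)%N](mxrank1 F).
(* The entrywise inverse of [d] inverts [diag_mx d] away from the zeros of [d], and [e] fills in the
   zeros. *)
have -> : 1%:M = diag_mx d *m diag_mx (\row_i (d 0 i)^-1) + diag_mx e.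
  rewrite mulmx_diag -linearD /= -diag_const_mx; congr diag_mx.
  apply/rowP=> i; rewrite !mxE; have [->|d_neq0] := eqVneq (d 0 i) 0.
    by rewrite mul0r add0r.
  by rewrite divff // addr0.
apply: leq_trans (mxrank_add _ _) _; rewrite leq_add ?mxrankM_maxl //.
exact: mxrank_diag_le.
Qed.

Lemma char_poly_conj (F : fieldType) n (P A : 'M[F]_n) : P \in unitmx ->
  char_poly (invmx P *m A *m P) = char_poly A.
Proof.
move=> Pu; rewrite /char_poly.
have -> : char_poly_mx (invmx P *m A *m P) =
    map_mx polyC (invmx P) *m char_poly_mx A *m map_mx polyC P.
  rewrite /char_poly_mx !map_mxM mulmxBr mulmxBl; congr (_ - _).
  by rewrite mul_mx_scalar -scalemxAl -map_mxM mulVmx // map_mx1 scalemx1.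
by rewrite !det_mulmx mulrAC -det_mulmx -map_mxM mulVmx // map_mx1 det1 mul1r.
Qed.

(** * Spectral theorem for real symmetric matrices, via the complex numbers *)

Local Notation toC := (map_mx (real_complex _)).

Lemma toC_adj (R : rcfType) m n (A : 'M[R]_(m, n)) :
  (map_mx Num.conj (toC A)^T) = toC A^T.
Proof.
apply/matrixP=> i j; rewrite !mxE; apply: conj_Creal.
by apply/complex_realP; exists (A j i).
Qed.

(** Write [a] as u + i v with u, v real. The cross terms cancel by symmetry of [G], which leaves the
    sum of the form at u and at v. *)
Lemma complex_form_le0 (R : rcfType) n (G : 'M[R]_n) : G^T = G ->
  (forall u : 'rV_n, (u *m G *m u^T) 0 0 <= 0) ->
  forall a : 'rV[R[i]]_n, (a *m toC G *m map_mx Num.conj a^T) 0 0 <= 0.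
Proof.
move=> Gsym G_le0 a.
pose u := map_mx (@complex.Re R) a; pose v := map_mx (@complex.Im R) a.
have -> : a = toC u + 'i%C *: toC v.
  by apply/rowP=> i; rewrite !mxE; case: (a 0 i) => x y; simpc.
have conji : Num.conj ('i%C : R[i]) = - 'i%C.
  by apply/eqP; rewrite eq_complex /= oppr0 !eqxx.
rewrite linearD linearZ /= map_mxD map_mxZ /= conji !toC_adj.
rewrite !mulmxDr !mulmxDl -!scalemxAl -!scalemxAr scalerA -!map_mxM.
have uGv : u *m G *m v^T = v *m G *m u^T.
  transitivity (v *m G *m u^T)^T; first by rewrite !trmx_mul trmxK Gsym mulmxA.
  by apply/matrixP=> i j; rewrite !ord1 mxE.
rewrite uGv mulrN -expr2 sqr_i opprK scale1r scaleNr addrA addrK.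
rewrite -map_mxD mxE (_ : 0 = 0%:C%C) // lecR mxE.
by rewrite -[leRHS]addr0 lerD.
Qed.

(* The spectral theorem is only available over R[i]; the eigenvalues are real
   since they are the roots of a split real characteristic polynomial. *)
Lemma symmetric_diagonalization (R : rcfType) n (S : 'M[R]_n) (s : seq R) :
  S^T = S -> char_poly S = \prod_(x <- s) ('X - x%:P) ->
  exists (P : 'M[R[i]]_n) (d : 'rV[R]_n),
    [/\ P \is unitarymx,
        forall l, toC (S - l%:M) = invmx P *m diag_mx (toC (d - const_mx l)) *m P
      & perm_eq s [seq d 0 i | i <- index_enum 'I_n]].
Proof.
move=> Ssym Schar; set SC := toC S.
have SCherm : SC \is hermsymmx.
  by apply/is_hermitianmxP; rewrite expr0 scale1r /SC toC_adj Ssym.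
pose P := spectralmx SC; have Pu : P \in unitmx := spectral_unit SC.
have /orthomx_spectralP SCE := hermitian_normalmx SCherm.
pose d : 'rV[R]_n := map_mx (@complex.Re R) (spectral_diag SC).
have dE : toC d = spectral_diag SC.
  apply/rowP=> i; rewrite !mxE RRe_real //.
  by have /mxOverP := hermitian_spectral_diag_real SCherm; apply.
exists P, d; split.
- exact: spectral_unitarymx.
- move=> l; rewrite !map_mxB linearB /= dE mulmxBr mulmxBl -SCE map_const_mx.
  by rewrite diag_const_mx map_scalar_mx mul_mx_scalar -scalemxAl mulVmx ?scalemx1.
(* Both sequences, embedded in [R[i]], list the roots of the same split characteristic
   polynomial. *)
apply/(perm_map_inj (@complexI R))/prod_XsubC_eq.
have : char_poly SC = map_poly (real_complex R) (char_poly S).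
  by rewrite -map_char_poly.
rewrite {1}SCE char_poly_conj // -dE char_poly_trig ?diag_mx_is_trig // Schar.
rewrite rmorph_prod /= !big_map.
under [in X in _ = X -> _]eq_bigr do rewrite map_polyXsubC.
by move=> <-; apply: eq_bigr => i _; rewrite !mxE eqxx mulr1n.
Qed.

(** After diagonalization the corank counts the diagonal entries equal to [l], and these are the
    occurrences of [l] in [s]. *)
Lemma corank_eigen_le (R : rcfType) n (S : 'M[R]_n) (s : seq R) (l : R) :
  S^T = S -> char_poly S = \prod_(x <- s) ('X - x%:P) ->
  (n <= \rank (S - l%:M)%R + count_mem l s)%N.
Proof.
move=> Ssym Schar.
have [P [d [/unitarymx_unit Pu SlE /permP->]]] :=
  symmetric_diagonalization Ssym Schar.
rewrite -(mxrank_map (real_complex R)) SlE.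
rewrite mxrankMfree ?row_free_unit // eqmxMfull ?row_full_unit ?unitmx_inv //.
rewrite -map_diag_mx mxrank_map.
apply: leq_trans (corank_diag (d - const_mx l)) _; rewrite leq_add2l.
rewrite -sum1_count big_map sum1_card eq_leq //; apply: eq_card => i.
by rewrite !inE !mxE subr_eq0.
Qed.

(** [B] extracts the coordinates along eigenvectors with eigenvalue below [l]. If they vanish at
    [a *m F], the form there is a sum of nonnegative terms; being nonpositive, it has only zero
    terms, so [S - l%:M] kills [a *m F]. Hence the rank is at most that of [B]. *)
Lemma rank_nonpos_form_le (R : rcfType) n (S : 'M[R]_n) (s : seq R) (l : R)
    p (F : 'M[R]_(p, n)) :
  S^T = S -> char_poly S = \prod_(x <- s) ('X - x%:P) ->
  (forall a : 'rV_p, (a *m F *m (S - l%:M) *m (a *m F)^T) 0 0 <= 0) ->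
  (\rank (F *m (S - l%:M))%R <= count (fun x => x < l)%R s)%N.
Proof.
move=> Ssym Schar F_npos.
have [P [d [Puni SlE /permP->]]] := symmetric_diagonalization Ssym Schar.
have Pu := unitarymx_unit Puni.
pose e : 'rV[R]_n := \row_i (d 0 i < l)%R%:R.
pose B := invmx P *m diag_mx (toC e).
have rkB : (\rank B <= count (fun x => x < l)%R [seq d 0%R i | i <- index_enum 'I_n])%N.
  rewrite eqmxMfull ?row_full_unit ?unitmx_inv //.
  rewrite -map_diag_mx mxrank_map; apply: leq_trans (mxrank_diag_le _) _.
  rewrite -sum1_count big_map sum1_card eq_leq //; apply: eq_card => i.
  rewrite inE !mxE -[RHS]/(d 0 i < l); case: (d 0 i < l); by rewrite ?oner_neq0 ?eqxx.
apply: leq_trans rkB.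
rewrite -(mxrank_map (real_complex R)) map_mxM /=.
apply: leq_trans (mxrankM_maxr (toC F) B).
suff kerS : (kermx (toC F *m B) <= kermx (toC F *m toC (S - l%:M)))%MS.
  by move/mxrankS: kerS; rewrite !mxrank_ker leq_sub2lE ?rank_leq_row.
apply/rV_subP => a /sub_kermxP; rewrite mulmxA mulmxA => aFB.
apply/sub_kermxP; rewrite SlE !mulmxA.
set w := a *m toC F *m invmx P in aFB *.
have: (a *m toC (F *m (S - l%:M) *m F^T) *m map_mx Num.conj a^T) 0 0 <= 0.
  apply: complex_form_le0 => [|u].
    by rewrite !trmx_mul trmxK linearB /= tr_scalar_mx Ssym mulmxA.
  by move: (F_npos u); rewrite trmx_mul !mulmxA.
rewrite !map_mxM /= SlE -toC_adj !mulmxA -/w.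
have -> : w *m diag_mx (toC (d - const_mx l)) *m P *m map_mx Num.conj (toC F)^T
     *m map_mx Num.conj a^T
   = w *m diag_mx (toC (d - const_mx l)) *m map_mx Num.conj w^T.
  by rewrite /w (invmx_unitary Puni) !trmx_mul !map_mxM /= trmxCK !mulmxA.
move=> form_le0; suff -> : w *m diag_mx (toC (d - const_mx l)) = 0 by rewrite mul0mx.
move: form_le0; rewrite mul_mx_diag mxE => sum_le0; clearbody w.
have term_ge0 i : 0 <= w 0 i * (d 0 i - l)%:C%C * Num.conj (w 0 i).
  have [d_lt|d_ge] := ltP (d 0 i) l.
    have /rowP/(_ i) := aFB; rewrite mul_mx_diag !mxE d_lt mulr1 => ->.
    by rewrite !mul0r.
  by rewrite mulrAC mulr_ge0 ?mul_conjC_ge0 // ler0c subr_ge0.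
apply/rowP=> i; rewrite !mxE.
have : \sum_j w 0 j * (d 0 j - l)%:C%C * Num.conj (w 0 j) = 0.
  apply/eqP; rewrite eq_le sumr_ge0 // andbT; apply: le_trans sum_le0.
  by rewrite le_eqVlt; apply/orP; left; apply/eqP/eq_bigr => j _; rewrite !mxE.
move/psumr_eq0P => /(_ (fun j _ => term_ge0 j) i isT)/eqP; rewrite mulf_eq0 conjC_eq0.
by case/orP=> /eqP; [|move->; rewrite mul0r].
Qed.

(** * The pencil K - l D, reduced to a symmetric eigenvalue problem *)

(* With N = D^(-1/2), the matrix N K N is symmetric and similar to D^-1 K. *)
Lemma pencil_symmetrization (R : rcfType) n (K : 'M[R]_n) (d : 'rV[R]_n) :
  K^T = K -> (forall i, 0 < d 0 i) ->
  exists N : 'M[R]_n,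
    [/\ N \in unitmx, N^T = N,
        char_poly (N *m K *m N) = char_poly (invmx (diag_mx d) *m K)
      & forall l, N *m K *m N - l%:M = N *m (K - l *: diag_mx d) *m N].
Proof.
move=> Ksym d_gt0; pose r : 'rV[R]_n := \row_i Num.sqrt (d 0 i).
pose N := diag_mx (\row_i (r 0 i)^-1).
have r_neq0 i : r 0 i != 0 by rewrite mxE gt_eqF // sqrtr_gt0.
have rN : diag_mx r *m N = 1%:M.
  rewrite mulmx_diag -diag_const_mx; congr diag_mx.
  by apply/rowP=> i; rewrite mxE [X in _ * X]mxE divff // mxE.
have NdN : N *m diag_mx d *m N = 1%:M.
  rewrite !mulmx_diag -diag_const_mx; congr diag_mx; apply/rowP=> i.
  rewrite [LHS]mxE [X in X * _]mxE ![(\row_i (r 0 i)^-1) 0 i]mxE mulrAC -invfM.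
  by rewrite -expr2 mxE sqr_sqrtr ?ltW // mulVf ?gt_eqF // mxE.
have [Nu ru] := (mulmx1_unit rN); exists N; split=> //.
- exact: tr_diag_mx.
- have du : diag_mx d \in unitmx.
    by move/mulmx1_unit: NdN => [+ _]; rewrite unitmx_mul => /andP[].
  rewrite -[RHS](char_poly_conj _ ru); congr char_poly.
  congr (_ *m N); rewrite !mulmxA; congr (_ *m K).
  apply: (can_inj (mulmxK du)); rewrite -[RHS]mulmxA mulVmx // mulmx1.
  by apply: (can_inj (mulmxK ru)); rewrite NdN mulVmx.
- move=> l; rewrite mulmxBr mulmxBl; congr (_ - _).
  by rewrite -scalemxAr -scalemxAl NdN scalemx1.
Qed.

Section Pencil.
Variables (R : rcfType) (n : nat) (K : 'M[R]_n) (d : 'rV[R]_n) (s : seq R) (l : R).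
Hypotheses (Ksym : K^T = K) (d_gt0 : forall i, 0 < d 0 i).
Hypothesis charK : char_poly (invmx (diag_mx d) *m K) = \prod_(x <- s) ('X - x%:P).

Let M := K - l *: diag_mx d.

Lemma corank_pencil_le : (n <= \rank M + count_mem l s)%N.
Proof.
have [N [Nu Nsym NE ME]] := pencil_symmetrization Ksym d_gt0.
have Ssym : (N *m K *m N)^T = N *m K *m N by rewrite !trmx_mul Nsym Ksym mulmxA.
have := corank_eigen_le l Ssym (etrans NE charK).
by rewrite ME mxrankMfree ?row_free_unit // eqmxMfull ?row_full_unit.
Qed.

Lemma rank_pencil_le p (F : 'M[R]_(p, n)) :
  (forall a : 'rV_p, (a *m F *m M *m (a *m F)^T) 0 0 <= 0) ->
  (\rank (F *m M) <= count (fun x => x < l)%R s)%N.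
Proof.
move=> F_npos; have [N [Nu Nsym NE ME]] := pencil_symmetrization Ksym d_gt0.
have Ssym : (N *m K *m N)^T = N *m K *m N by rewrite !trmx_mul Nsym Ksym mulmxA.
(* The factor [invmx N] undoes the congruence: (F N^-1)(N M N) = F M N, so the form in question is
   that of [M] on the rows of [F]. *)
have := @rank_nonpos_form_le R n _ s l p (F *m invmx N) Ssym (etrans NE charK).
rewrite ME !mulmxA mulmxKV // mxrankMfree ?row_free_unit //; apply => a.
rewrite !mulmxA mulmxKV // !trmx_mul trmx_inv Nsym !mulmxA mulmxK //.
by move: (F_npos a); rewrite trmx_mul !mulmxA.
Qed.

End Pencil.

(** * The quadratic form on weightings of f that are constant on labels *)

Section Labelling.
Variables (R : realFieldType) (n : nat) (M : 'M[R]_n) (f : 'cV[R]_n).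
Variables (T : finType) (h : 'I_n -> T).
Hypotheses (Msym : M^T = M) (Mf : M *m f = 0).
Hypothesis offdiag_ge0 : forall x y, h x != h y -> 0 <= f x 0 * M x y * f y 0.

Let L : {set T} := h @: [set x | f x 0 != 0].

(** The rows are the restrictions of [f] to the label classes, so [a *m label_mx] is the weighted
    function c f with c = [label_coef a]. Restricting to labels of nonzeros makes the rows
    independent. *)
Definition label_mx : 'M[R]_(#|L|, n) :=
  \matrix_(i, x) (f x 0 *+ (h x == enum_val i)).

Definition label_coef (a : 'rV[R]_#|L|) (x : 'I_n) : R :=
  \sum_i a 0 i *+ (h x == enum_val i).

Lemma mul_label_mx a x : (a *m label_mx) 0 x = label_coef a x * f x 0.
Proof.
rewrite mxE mulr_suml; apply: eq_bigr => i _.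
by rewrite mxE mulrnAr mulrnAl.
Qed.

Lemma label_coef_eq a x y : h x = h y -> label_coef a x = label_coef a y.
Proof. by rewrite /label_coef => ->. Qed.

Lemma label_coef0 a : (forall x, f x 0 != 0 -> label_coef a x = 0) -> a = 0.
Proof.
move=> a0; apply/rowP=> i; rewrite mxE.
have /imsetP[x] := enum_valP i; rewrite inE => /a0 + hx.
rewrite /label_coef (bigD1 i) //= -hx eqxx big1 ?addr0 // => j ji.
by rewrite (inj_eq enum_val_inj) eq_sym (negPf ji).
Qed.

Lemma label_mx_row_free : row_free label_mx.
Proof.
apply: inj_row_free => a aF0; apply: label_coef0 => x fx.
move/rowP/(_ x): aF0; rewrite mul_label_mx mxE => /eqP.
by rewrite mulf_eq0 (negPf fx) orbF => /eqP.
Qed.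

(** Expanding the square, the terms in c(x)^2 and c(y)^2 sum to zero because each row sum of f(x)
    M_xy f(y) is f(x) (M f)(x) = 0. Only the cross terms remain, and they make up twice the form. *)
Lemma form_label a :
  (a *m label_mx *m M *m (a *m label_mx)^T) 0 0 *+ 2 =
  - \sum_x \sum_y (label_coef a x - label_coef a y) ^+ 2 * (f x 0 * M x y * f y 0).
Proof.
pose c := label_coef a; pose m x y := f x 0 * M x y * f y 0.
have formE : (a *m label_mx *m M *m (a *m label_mx)^T) 0 0 =
    \sum_x \sum_y c x * c y * m x y.
  have: forall x, (a *m label_mx) 0 x = c x * f x 0 by apply: mul_label_mx.
  move: (a *m label_mx) => v vE; rewrite mxE exchange_big /=; apply: eq_bigr => y _.
  rewrite [v^T _ _]mxE mxE mulr_suml; apply: eq_bigr => x _.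
  by rewrite !vE /m; ring.
have row0 x : \sum_y m x y = 0.
  transitivity (f x 0 * (M *m f) x 0); last by rewrite Mf mxE mulr0.
  by rewrite mxE mulr_sumr; apply: eq_bigr => y _; rewrite mulrA.
have m_sym x y : m x y = m y x by rewrite /m -[in LHS]Msym mxE; ring.
have sqx : \sum_x \sum_y c x ^+ 2 * m x y = 0.
  by rewrite big1 // => x _; rewrite -mulr_sumr row0 mulr0.
have sqy : \sum_x \sum_y c y ^+ 2 * m x y = 0.
  rewrite exchange_big -[RHS]sqx; apply: eq_bigr => y _; apply: eq_bigr => x _.
  by rewrite m_sym.
rewrite formE mulr2n.
transitivity (- (\sum_x \sum_y c x ^+ 2 * m x y + \sum_x \sum_y c y ^+ 2 * m x y
   - (\sum_x \sum_y c x * c y * m x y + \sum_x \sum_y c x * c y * m x y))).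
  by rewrite sqx sqy addr0 sub0r opprK.
rewrite -!big_split -sumrN -big_split /=; congr (- _); apply: eq_bigr => x _.
rewrite -!big_split -sumrN -big_split /=; apply: eq_bigr => y _.
rewrite -/c -/(m x y); ring.
Qed.

Lemma form_term_ge0 a x y :
  0 <= (label_coef a x - label_coef a y) ^+ 2 * (f x 0 * M x y * f y 0).
Proof.
have [hxy|hxy] := eqVneq (h x) (h y).
  by rewrite (label_coef_eq a hxy) subrr expr0n mul0r.
by rewrite mulr_ge0 ?sqr_ge0 ?offdiag_ge0.
Qed.

Lemma form_label_le0 (a : 'rV[R]_#|L|) :
  (a *m label_mx *m M *m (a *m label_mx)^T) 0 0 <= 0.
Proof.
rewrite -(pmulrn_lle0 _ (isT : 0 < 2)%N) // form_label oppr_le0.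
by apply: sumr_ge0 => x _; apply: sumr_ge0 => y _; apply: form_term_ge0.
Qed.

(** The form vanishes at such an [a], so every term of the nonnegative double sum is zero. *)
Lemma kernel_label_coef_eq a x y : a *m label_mx *m M = 0 ->
  f x 0 * M x y * f y 0 != 0 -> label_coef a x = label_coef a y.
Proof.
move=> aFM mxy; have := form_label a; rewrite aFM mul0mx mxE mul0rn.
move/esym/eqP; rewrite oppr_eq0 psumr_eq0 => [/allP/(_ x)|x' _]; last first.
  by apply: sumr_ge0 => y' _; apply: form_term_ge0.
rewrite mem_index_enum => /(_ isT)/=; rewrite psumr_eq0 => [/allP/(_ y)|y' _]; last first.
  exact: form_term_ge0.
rewrite mem_index_enum => /(_ isT)/=; rewrite mulf_eq0 (negPf mxy) orbF.
by rewrite expf_eq0 /= subr_eq0 => /eqP.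
Qed.

End Labelling.

(** * Signed walks through zeros of f, and how they extend S-paths and W-paths *)

Section SignedWalks.
Variables (R : realType) (n : nat) (G : signed_hypergraph n) (f : 'cV[R]_n).

Let sg (e : {set 'I_n}) : R := (sgn_edge G e)%:~R.

Lemma sgn_edge_neq0 e : e \in edges G -> sg e != 0.
Proof.
move=> eE; rewrite intr_eq0 mulf_neq0 ?expf_neq0 //.
by apply/prodf_neq0 => v ve; case: (isignP eE ve) => ->.
Qed.

Lemma R_S_step x y e w : e \in edges G -> x \in e -> y \in e ->
  0 < f x 0 * sg e * f y 0 -> R_S G f y w -> R_S G f x w.
Proof.
move=> eE xe ye pos yw.
have {yw} [l [X [X0 Xl XP]]] : exists l X, [/\ X 0%N = y, X l = w & S_path G f l X].
  by case: yw => [->|//]; exists 0%N, (fun _ => w).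
right; exists l.+1, (fun t => if t is t'.+1 then X t' else x); split=> //.
case=> [|j] jl; last exact: XP.
by exists e; rewrite X0.
Qed.

(* The sign is the product of the edge signs; all vertices but the two end
   points are zeros of [f], and nothing is asked of the end points. *)
Inductive zero_walk : 'I_n -> R -> 'I_n -> Prop :=
| ZeroWalkEdge e x y of e \in edges G & x \in e & y \in e : zero_walk x (sg e) y
| ZeroWalkCons e x z s y of e \in edges G & x \in e & z \in e & f z 0 = 0
    & zero_walk z s y : zero_walk x (sg e * s) y.

Lemma zero_walk_rcons e x s z y : zero_walk x s z -> f z 0 = 0 ->
  e \in edges G -> z \in e -> y \in e -> zero_walk x (s * sg e) y.
Proof.
move=> xz fz eE ze ye; elim: xz fz ze => [e' x' z' eE' xe' ze' fz' ze|].
  by apply: ZeroWalkCons (ZeroWalkEdge eE ze ye).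
move=> e' x' z1 s' z' eE' xe' ze' fz1 _ IH fz' ze; rewrite -mulrA.
exact: ZeroWalkCons (IH fz' ze).
Qed.

Lemma zero_walk_sym x s y : zero_walk x s y -> zero_walk y s x.
Proof.
elim=> [e x' y' eE xe ye|e x' z s' y' eE xe ze fz _ IH].
  exact: ZeroWalkEdge.
by rewrite mulrC; apply: zero_walk_rcons IH _ _ _ _.
Qed.

Lemma zero_walk_neq0 x s y : zero_walk x s y -> s != 0.
Proof.
by elim=> [e ? ? eE _ _|e ? ? ? ? eE _ _ _ _ ?]; rewrite ?mulf_neq0 ?sgn_edge_neq0.
Qed.

Lemma zero_walk_seq x s y : zero_walk x s y ->
  exists l (X : nat -> 'I_n) (e : nat -> {set 'I_n}),
    [/\ X 0%N = x, X l.+1 = y,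
        forall t, (t < l.+1)%N -> [/\ e t \in edges G, X t \in e t & X t.+1 \in e t],
        forall t, (0 < t < l.+1)%N -> f (X t) 0 = 0
      & \prod_(0 <= t < l.+1) sg (e t) = s].
Proof.
elim=> [e x' y' eE xe ye|e x' z s' y' eE xe ze fz _ [l [X [es [X0 Xl XE Xf <-]]]]].
  exists 0%N, (fun t => if t is 0%N then x' else y'), (fun _ => e); split=> //.
  - by case.
  - by case.
  - by rewrite big_nat1.
exists l.+1, (fun t => if t is t'.+1 then X t' else x'),
  (fun t => if t is t'.+1 then es t' else e); split=> //.
- by case=> [|t] tl; [rewrite X0|apply: XE].
- by case=> [|[|t]] // tl; [rewrite X0|apply: Xf].
- by rewrite big_nat_recl.
Qed.

(** Concatenate the walk with a W-path from [y]. Since [f] is nonzero at the junction [y], no two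
    consecutive nonzeros straddle it: they are either the two ends of the walk or both on the
    W-path. *)
Lemma R_W_step x s y w : zero_walk x s y -> 0 < f x 0 * s * f y 0 ->
  R_W G f y w -> R_W G f x w.
Proof.
move=> /zero_walk_seq[l1 [X1 [e1 [X10 X1l X1E X1f <-]]]] pos yw.
set L := l1.+1 in X1l X1E X1f pos.
have fy : f y 0 != 0 by apply: contraTneq pos => ->; rewrite mulr0 ltxx.
have {yw} [l [X [e [X0 Xl [XE XW]]]]] :
    exists l X e, [/\ X 0%N = y, X l = w & W_path G f l X e].
  case: yw => [->|//]; exists 0%N, (fun _ => w), (fun _ => set0); split=> //.
  by split=> // i j ij; rewrite leqn0 => /eqP j0; rewrite j0 in ij.
pose Y t := if (t <= L)%N then X1 t else X (t - L)%N.
pose E t := if (t < L)%N then e1 t else e (t - L)%N.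
have Y_le t : (t <= L)%N -> Y t = X1 t by rewrite /Y => ->.
have Y_ge t : (L <= t)%N -> Y t = X (t - L)%N.
  rewrite /Y; case: (ltngtP t L) => // ->; by rewrite subnn X0 X1l.
right; exists (L + l)%N, Y, E; split.
- by rewrite Y_le.
- by rewrite Y_ge ?leq_addr // addKn.
split=> [t tl|i j ij jl fi fj fij].
  rewrite /E; case: (ltnP t L) => tL; first by rewrite !Y_le ?(ltnW tL) //; apply: X1E.
  by rewrite !Y_ge ?(leq_trans tL) // subSn //; apply: XE; lia.
(* Inside the walk the only possible nonzeros are its ends, at positions 0 and [L]. *)
have [jL|jL] := leqP j L.
  have i0 : i = 0%N.
    apply/eqP; rewrite -leqn0 leqNgt; apply: contra fi => i_gt0.
    by rewrite Y_le ?X1f ?i_gt0 ?(leq_trans ij) //; lia.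
  have jE : j = L.
    apply/eqP; rewrite eqn_leq jL leqNgt; apply: contra fj => j_ltL.
    by rewrite Y_le ?X1f // j_ltL andbT; lia.
  rewrite i0 jE !Y_le // X10 X1l.
  rewrite (eq_big_nat _ _ (F2 := fun t => sg (e1 t))) // => t /andP[_ tL].
  by rewrite /E tL.
have iL : (L <= i)%N.
  rewrite leqNgt; apply: contra fy => iL.
  have <- : Y L = y by rewrite Y_le.
  by rewrite fij.
rewrite !Y_ge ?(ltnW jL) // in fi fj *.
have -> : \prod_(i <= t < j) (sgn_edge G (E t))%:~R
    = \prod_(i - L <= t < j - L) (sgn_edge G (e t))%:~R :> R.
  rewrite -{1}(subnK iL) big_addn; apply: eq_big_nat => t _.
  by rewrite /E ltnNge leq_addl addnK.
apply: XW => //; [lia|lia|move=> t it tj].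
have <- : Y (t + L)%N = X t by rewrite Y_ge ?leq_addl // addnK.
by apply: fij; lia.
Qed.

End SignedWalks.

(** * Adjacency signs, and constancy of the weights on connected components *)

Section SignedAdjacency.
Variables (R : realType) (n : nat) (G : signed_hypergraph n).
Let sg (e : {set 'I_n}) : R := (sgn_edge G e)%:~R.

Lemma adj_mulE (x y : 'I_n) (u : R) : x != y ->
  adj_mx R G x y * u = \sum_(e in edges G | (x \in e) && (y \in e)) sg e * u.
Proof. by move=> /negPf xy; rewrite mxE xy mulr_suml. Qed.

Lemma adj_mul_le0 (x y : 'I_n) (u : R) :
  (forall e, e \in edges G -> x \in e -> y \in e -> sg e * u <= 0) ->
  adj_mx R G x y * u <= 0.
Proof.
move=> sgu; have [<-|xy] := eqVneq x y; first by rewrite mxE eqxx mul0r.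
by rewrite adj_mulE // sumr_le0 // => e /and3P[]; apply: sgu.
Qed.

Lemma adj_mul_lt0 (x y : 'I_n) (u : R) e0 : x != y ->
  e0 \in edges G -> x \in e0 -> y \in e0 ->
  (forall e, e \in edges G -> x \in e -> y \in e -> sg e * u < 0) ->
  adj_mx R G x y * u < 0.
Proof.
move=> xy e0E xe0 ye0 sgu; rewrite adj_mulE // (bigD1 e0) ?e0E ?xe0 //=.
rewrite ltr_wnDr ?sgu // sumr_le0 // => e /andP[/and3P[eE xe ye] _].
by rewrite ltW ?sgu.
Qed.

Lemma adj_sym : (adj_mx R G)^T = adj_mx R G.
Proof.
apply/matrixP=> x y; rewrite !mxE eq_sym; case: eqP => // _.
by apply: eq_bigl => e; rewrite [(y \in e) && _]andbC.
Qed.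

(** Here [c] stands for the weights of a c f killed by M: [c_walk] reflects constancy on weak
    domains, [c_adj] the vanishing of the terms of the form, and the two sums are (M f)(z) = 0 and
    (M c f)(z) = 0 at a zero z. *)
Variables (f : 'cV[R]_n) (c : 'I_n -> R).
Hypothesis c_walk : forall x s y,
  zero_walk G f x s y -> 0 < f x 0 * s * f y 0 -> c x = c y.
Hypothesis c_adj : forall x y, x != y ->
  f x 0 * adj_mx R G x y * f y 0 != 0 -> c x = c y.
Hypothesis f_sum : forall z, f z 0 = 0 -> \sum_w adj_mx R G z w * f w 0 = 0.
Hypothesis cf_sum : forall z, f z 0 = 0 ->
  \sum_w adj_mx R G z w * (c w * f w 0) = 0.

Lemma walk_lt0 x s y : zero_walk G f x s y -> f x 0 != 0 -> f y 0 != 0 ->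
  c x != c y -> f x 0 * s * f y 0 < 0.
Proof.
move=> xy fx fy cxy; rewrite real_ltNge ?num_real // le_eqVlt negb_or.
rewrite eq_sym !mulf_neq0 ?(zero_walk_neq0 xy) //=.
by apply: contra cxy => /(c_walk xy)->.
Qed.

(** If the weights differed, every common edge would contribute a negative term. Nothing could
    cancel in A_xy, so f(x) A_xy f(y) would be nonzero, against [c_adj]. *)
Lemma c_edge e x y : e \in edges G -> x \in e -> y \in e ->
  f x 0 != 0 -> f y 0 != 0 -> c x = c y.
Proof.
move=> eE xe ye fx fy; apply/eqP/negPn/negP => cxy.
have xy : x != y by apply: contraNneq cxy => ->.
have: adj_mx R G x y * (f x 0 * f y 0) < 0.
  apply: (adj_mul_lt0 xy eE xe ye) => e' e'E xe' ye'.
  have := walk_lt0 (ZeroWalkEdge f e'E xe' ye') fx fy cxy.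
  by rewrite mulrA [sg _ * _]mulrC.
rewrite mulrA [_ * f x 0]mulrC => /ltr0_neq0/(c_adj xy) cE.
by rewrite cE eqxx in cxy.
Qed.

(** Suppose c(x) and c(y) differ. A nonzero neighbour w of [z] with c(w) different from c(y) reaches
    [y] through [z] with negative sign only, and then c(w) = c(x). So c takes only the values c(x)
    and c(y) on nonzero neighbours of [z], and the two sum conditions leave a vanishing sum over
    those with value c(x). Up to the factor [k] its terms are nonpositive, and negative at [x]. *)
Lemma c_zero_walk e x z u y : e \in edges G -> x \in e -> z \in e ->
  f z 0 = 0 -> zero_walk G f z u y -> f x 0 != 0 -> f y 0 != 0 -> c x = c y.
Proof.
move=> eE xe ze fz zy fx fy; apply/eqP/negPn/negP => cxy.
pose k := u * f y 0; have k_neq0 : k != 0 by rewrite mulf_neq0 ?(zero_walk_neq0 zy).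
have neg w e' : e' \in edges G -> w \in e' -> z \in e' -> f w 0 != 0 ->
    c w != c y -> sg e' * (f w 0 * k) < 0.
  move=> e'E we' ze' fw cwy.
  have := walk_lt0 (ZeroWalkCons e'E we' ze' fz zy) fw fy cwy.
  by congr (_ < _); rewrite /k /sg; ring.
have c_eq w e' : e' \in edges G -> w \in e' -> z \in e' -> f w 0 != 0 ->
    c w != c y -> c w = c x.
  move=> e'E we' ze' fw cwy.
  apply: (c_walk (ZeroWalkCons e'E we' ze' fz (ZeroWalkEdge f eE ze xe))).
  (* Two walks to [y] of negative sign compose to a positive one from [w] to [x]. *)
  have k2_gt0 : 0 < k ^+ 2 by rewrite exprn_even_gt0.
  have := neg _ _ e'E we' ze' fw cwy; have := neg _ _ eE xe ze fx cxy.
  rewrite -(pmulr_lgt0 _ k2_gt0) -/(sg e) -/(sg e').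
  have -> : f w 0 * (sg e' * sg e) * f x 0 * k ^+ 2
      = (sg e' * (f w 0 * k)) * (sg e * (f x 0 * k)) by ring.
  by move=> x_lt0 w_lt0; rewrite nmulr_rgt0.
(* Subtracting c(y) times [f_sum] from [cf_sum] removes the neighbours of weight c(y) and leaves the
   common factor c(x) - c(y). *)
have sum0 : (c x - c y) * \sum_(w | c w != c y) adj_mx R G z w * (f w 0 * k) = 0.
  transitivity (k * (\sum_w adj_mx R G z w * (c w * f w 0)
                 - c y * \sum_w adj_mx R G z w * f w 0)); last first.
    by rewrite f_sum // cf_sum // mulr0 subrr mulr0.
  rewrite [in RHS]mulr_sumr -sumrB !mulr_sumr big_mkcond; apply: eq_bigr => w _.
  case: eqP => [->|/eqP cwy]; first by rewrite -!mulrA /=; ring.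
  have [->|fw] := eqVneq (f w 0) 0; first by ring.
  have [->|Azw] := eqVneq (adj_mx R G z w) 0; first by ring.
  suff -> : c x = c w by ring.
  have zw : z != w by apply: contraNneq Azw => ->; rewrite mxE eqxx.
  have [[e' /and3P[e'E ze' we']]|noedge] :=
      pselect (exists e', [&& e' \in edges G, z \in e' & w \in e']).
    by rewrite (c_eq w e').
  case/eqP: Azw; rewrite -[LHS]mulr1 adj_mulE // big_pred0 // => e'.
  by apply/negP=> e'P; apply: noedge; exists e'.
move/eqP: sum0; rewrite mulf_eq0 subr_eq0 (negPf cxy) /= => /eqP sum0.
suff : \sum_(w | c w != c y) adj_mx R G z w * (f w 0 * k) < 0 by rewrite sum0 ltxx.
rewrite (bigD1 x) //= ltr_wnDr //; last first.
  have zx : z != x by apply: contraNneq fx => <-; rewrite fz.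
  by apply: (adj_mul_lt0 zx eE ze xe) => e' e'E ze' xe'; apply: neg.
apply: sumr_le0 => w /andP[cwy _].
apply: adj_mul_le0 => e' e'E ze' we'.
have [->|fw] := eqVneq (f w 0) 0; first by rewrite mul0r mulr0.
by rewrite ltW ?neg.
Qed.

Lemma c_path_connected x y : path_connected G x y ->
  f x 0 != 0 -> f y 0 != 0 -> c x = c y.
Proof.
move=> [l [X [e [X0 Xl _ _ XE]]]] fx fy.
(* Induction backwards from [y]: a nonzero vertex has the weight of [y], and a zero vertex has a
   zero walk to some nonzero of that weight. *)
have reach t : (t <= l)%N ->
  if f (X (l - t)%N) 0 != 0 then c (X (l - t)%N) = c y
  else exists u w, [/\ zero_walk G f (X (l - t)%N) u w, f w 0 != 0 & c w = c y].
  elim: t => [|t IH] tl; first by rewrite subn0 Xl fy.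
  have tl' : (l - t.+1 < l)%N by lia.
  have [eE] := XE _ tl'; have -> : (l - t.+1).+1 = (l - t)%N by lia.
  move: {IH tl'} (IH (ltnW tl)).
  move: (e _) (X (l - t.+1)%N) (X (l - t)%N) eE => e' v z e'E + ve ze.
  case: (eqVneq (f z 0) 0) => [fz [u [w [zw fw cw]]]|fz <-].
    case: (eqVneq (f v 0) 0) => [fv|fv]; last first.
      by rewrite -cw; apply: (c_zero_walk e'E ve ze fz zw).
    exists (sg e' * u), w; split=> //; exact: (ZeroWalkCons e'E ve ze fz zw).
  case: (eqVneq (f v 0) 0) => [fv|fv]; last exact: (c_edge e'E).
  exists (sg e'), z; split=> //; exact: ZeroWalkEdge.
by have := reach l (leqnn _); rewrite subnn X0 fx.
Qed.

End SignedAdjacency.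

(** * Classes as labels, connectedness, and the ordering of eigenvalues *)

(* [num_classes] counts these sets, so domains are labelled by them and it is
   never needed that [R_S] and [R_W] are equivalence relations. *)
Definition class_of (T : finType) (D : {set T}) (r : T -> T -> Prop) (x : T) : {set T} :=
  [set y in D | `[< r x y >]].

Lemma class_of_step (T : finType) (D : {set T}) (r : T -> T -> Prop) x y :
  (forall z, r y z -> r x z) -> (forall z, r x z -> r y z) ->
  class_of D r x = class_of D r y.
Proof.
move=> yx xy; apply/setP=> z; rewrite !inE; congr (_ && _).
by apply/asboolP/asboolP; [apply: xy|apply: yx].
Qed.

Lemma num_components_connected n (G : signed_hypergraph n) :
  hconnected G -> (num_components G <= 1)%N.
Proof.
move=> Gconn; rewrite -(cards1 [set: 'I_n]); apply/subset_leq_card.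
apply/subsetP => _ /imsetP[x _ ->].
by rewrite inE; apply/eqP/setP=> y; rewrite !inE; apply/asboolP.
Qed.

Lemma path_connected_refl n (G : signed_hypergraph n) x : path_connected G x x.
Proof.
exists 0%N, (fun _ => x), (fun _ => set0); split=> // i j.
by rewrite !leqn0 => /eqP-> /eqP->.
Qed.

(** By monotonicity only indices 1 to k - 1 can give values below [lam k]. *)
Lemma count_lt_nth (R : realType) n (lam : nat -> R) k :
  (forall i j, (1 <= i)%N -> (i <= j)%N -> (j <= n)%N -> lam i <= lam j) ->
  (1 <= k <= n)%N ->
  (count (fun x => x < lam k)%R [seq lam i | i <- index_iota 1 n.+1] <= k.-1)%N.
Proof.
move=> lam_mono /andP[k_ge1 k_len].
have -> : index_iota 1 n.+1 = iota 1 k.-1 ++ iota k (n.+1 - k).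
  rewrite /index_iota -[X in _ ++ iota X _](_ : 1 + k.-1 = k)%N -?iotaD.
    by congr iota; lia.
  by lia.
rewrite map_cat count_cat -[leqRHS]addn0 leq_add //.
  by rewrite (leq_trans (count_size _ _)) // size_map size_iota.
rewrite leqn0 -leqn0 leqNgt -has_count; apply/hasPn => _ /mapP[i + ->].
rewrite mem_iota => /andP[ki ilt]; rewrite -leNgt lam_mono //; lia.
Qed.

(** * The dimension counts for strong and weak nodal domains *)

Section Counting.
Variables (R : realType) (n : nat) (G : signed_hypergraph n).
Hypothesis deg_gt0 : forall i : 'I_n, (0 < deg G i)%N.
Variables (l : R) (s : seq R) (f : 'cV[R]_n).
Hypothesis charL : char_poly (normalized_laplacian R G) = \prod_(x <- s) ('X - x%:P).
Hypothesis Lf : normalized_laplacian R G *m f = l *: f.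
Let below := count (fun x => x < l)%R s.

Let A := adj_mx R G.
Let d : 'rV[R]_n := \row_i (deg G i)%:R.
Let K := deg_mx R G - A.
Let M := K - l *: diag_mx d.

Let d_gt0 i : 0 < d 0 i. Proof. by rewrite mxE ltr0n. Qed.

Let Ksym : K^T = K.
Proof. by rewrite linearB /= adj_sym tr_diag_mx. Qed.

Let Msym : M^T = M.
Proof. by rewrite linearB linearZ /= Ksym tr_diag_mx. Qed.

Let deg_unit : deg_mx R G \in unitmx.
Proof.
rewrite unitmxE det_diag unitfE; apply/prodf_neq0 => i _.
by rewrite gt_eqF ?d_gt0.
Qed.

Let LE : normalized_laplacian R G = invmx (diag_mx d) *m K.
Proof. by rewrite mulmxBr mulVmx. Qed.

Let Mf : M *m f = 0.
Proof.
rewrite mulmxBl -scalemxAl scalemxAr -Lf LE mulmxA mulKVmx ?subrr //.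
Qed.

Let M_offdiag x y : x != y -> M x y = - A x y.
Proof. by move=> /negPf xy; rewrite !mxE xy mulr0n mulr0 subr0 sub0r. Qed.

Let charK : char_poly (invmx (diag_mx d) *m K) = \prod_(x <- s) ('X - x%:P).
Proof. by rewrite -LE. Qed.

Section Label.
Variables (T : finType) (h : 'I_n -> T).
Hypothesis adj_le0 : forall x y, h x != h y -> f x 0 * A x y * f y 0 <= 0.

Let offdiag_ge0 x y : h x != h y -> 0 <= f x 0 * M x y * f y 0.
Proof.
move=> hxy; have xy : x != y by apply: contraNneq hxy => ->.
by rewrite M_offdiag // mulrN mulNr oppr_ge0 adj_le0.
Qed.

Let F := label_mx f h.

Lemma rank_label_pencil : (\rank (F *m M) <= below)%N.
Proof. by apply: (rank_pencil_le Ksym d_gt0 charK) => a; apply: form_label_le0. Qed.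

(** The row space of [F] has one dimension per label. Its image under [M] has dimension at most
    [below], and its part killed by [M] lies in an eigenspace of dimension at most the multiplicity
    of [l]. *)
Lemma num_labels_le_mult : (#|h @: nonzeros f| <= below + count_mem l s)%N.
Proof.
have Ffree : \rank F = #|h @: nonzeros f| by apply/eqP; apply: label_mx_row_free.
rewrite -Ffree -(mxrank_mul_ker F M) leq_add ?rank_label_pencil //.
apply: leq_trans (mxrankS (capmxSr _ _)) _; rewrite mxrank_ker leq_subLR.
exact: corank_pencil_le.
Qed.

Hypothesis h_walk : forall x s y,
  zero_walk G f x s y -> 0 < f x 0 * s * f y 0 -> h x = h y.

(** Weights killed by [F *m M] are constant on the nonzeros of each component, so one value per
    component determines them: [E] is injective on that kernel. *)
Lemma num_labels_le_components :
  (#|h @: nonzeros f| <= below + num_components G)%N.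
Proof.
pose P := class_of [set: 'I_n] (path_connected G).
have -> : num_components G = #|P @: [set: 'I_n]| by [].
(* [a *m E] lists the weights of [a] at one nonzero of [f] per component. *)
pose E : 'M[R]_(#|h @: nonzeros f|, #|P @: [set: 'I_n]|) := \matrix_(i, j)
  if [pick x | (f x 0 != 0) && (P x == enum_val j)] is Some x
  then (h x == enum_val i)%:R else 0.
have ker_triv (a : 'rV_#|h @: nonzeros f|) : a *m (F *m M) = 0 -> a *m E = 0 -> a = 0.
  rewrite mulmxA => aFM aE; apply: label_coef0 => x fx.
  have Px : P x \in P @: [set: 'I_n] by apply: imset_f.
  have := congr1 (fun v : 'rV_ _ => v 0 (enum_rank_in Px (P x))) aE.
  rewrite mxE [RHS]mxE; under eq_bigr do rewrite mxE enum_rankK_in //.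
  case: pickP => [x' /andP[fx' /eqP Px'] coef0|/(_ x)]; last by rewrite fx eqxx.
  have {}coef0 : label_coef a x' = 0.
    by rewrite -[RHS]coef0; apply: eq_bigr => i _; rewrite mulr_natr.
  rewrite -[RHS]coef0; apply/esym.
  apply/(c_path_connected (G := G) (c := label_coef a) _ _ _ _ _ fx' fx).
  - by move=> y t z yz pos; apply/label_coef_eq/(h_walk yz).
  - move=> y z yz Ayz; apply: (kernel_label_coef_eq Msym Mf offdiag_ge0 aFM).
    by rewrite M_offdiag // mulrN mulNr oppr_eq0.
  - move=> z fz; transitivity (- (M *m f) z 0); last by rewrite Mf mxE oppr0.
    rewrite mxE -sumrN; apply: eq_bigr => w _.
    have [<-|zw] := eqVneq z w; first by rewrite fz !mulr0 oppr0.
    by rewrite M_offdiag // mulNr opprK.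
  - move=> z fz; transitivity (- (a *m F *m M) 0 z); last by rewrite aFM mxE oppr0.
    rewrite [(a *m F *m M) 0 z]mxE -sumrN; apply: eq_bigr => w _; rewrite mul_label_mx.
    have [<-|zw] := eqVneq z w; first by rewrite fz !(mulr0, mul0r) oppr0.
    by rewrite -Msym [M^T w z]mxE M_offdiag // mulrN opprK mulrC.
  - have : x \in P x by rewrite !inE; apply/asboolP/path_connected_refl.
    by rewrite -Px' inE => /andP[_ /asboolP].
have : (\rank (kermx (F *m M)) <= #|P @: [set: 'I_n]|)%N.
  rewrite -(mxrank_mul_ker _ E) [X in (_ + \rank X)%N](_ : _ = 0).
    by rewrite mxrank0 addn0 rank_leq_col.
  apply/eqP/rowV0P => a; rewrite sub_capmx => /andP[/sub_kermxP aFM /sub_kermxP aE].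
  exact: ker_triv.
rewrite mxrank_ker leq_subLR => /leq_trans; apply.
by rewrite leq_add2r rank_label_pencil.
Qed.

End Label.

(** An edge with positive term between [x] and [y] is an S-step and merges their classes, so
    distinct classes see only nonpositive terms. *)
Lemma num_strong_nodal_le : (num_strong_nodal G f <= below + count_mem l s)%N.
Proof.
apply: (@num_labels_le_mult _ (class_of (nonzeros f) (R_S G f))) => x y hxy.
rewrite [f x 0 * _]mulrC -mulrA; apply: adj_mul_le0 => e eE xe ye.
rewrite real_leNgt ?num_real //; apply: contra hxy => pos.
apply/eqP/class_of_step => w; [apply: (R_S_step eE xe ye)|apply: (R_S_step eE ye xe)].
  by rewrite [f x 0 * _]mulrC -mulrA.
by rewrite [f y 0 * _]mulrC -mulrA [f y 0 * _]mulrC.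
Qed.

Lemma num_weak_nodal_le : (num_weak_nodal G f <= below + num_components G)%N.
Proof.
have h_walk x t y : zero_walk G f x t y -> 0 < f x 0 * t * f y 0 ->
    class_of (nonzeros f) (R_W G f) x = class_of (nonzeros f) (R_W G f) y.
  move=> xy pos; apply: class_of_step => w; first exact: R_W_step xy pos.
  apply: R_W_step (zero_walk_sym xy) _; by rewrite mulrC mulrA mulrAC.
apply: (@num_labels_le_components _ (class_of (nonzeros f) (R_W G f))) => // x y hxy.
rewrite [f x 0 * _]mulrC -mulrA; apply: adj_mul_le0 => e eE xe ye.
rewrite real_leNgt ?num_real //; apply: contra hxy => pos.
apply/eqP; apply: h_walk (ZeroWalkEdge f eE xe ye) _.
by rewrite [f x 0 * _]mulrC -mulrA.
Qed.

End Counting.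

Theorem theorem4p1 (R : realType) (n : nat) (G : signed_hypergraph n)
  (deg_gt0 : forall i : 'I_n, (0 < deg G i)%N)
  (lam : nat -> R)
  (lam_nondecreasing :
     forall i j, (1 <= i)%N -> (i <= j)%N -> (j <= n)%N -> lam i <= lam j)
  (lam_eigenvalues :
     char_poly (normalized_laplacian R G)
       = \prod_(1 <= i < n.+1) ('X - (lam i)%:P))
  (k : nat) (k_ge1 : (1 <= k)%N) (k_len : (k <= n)%N)
  (f : 'cV[R]_n) (f_neq0 : f != 0)
  (f_eigen : normalized_laplacian R G *m f = lam k *: f) :
  let r := mup (lam k) (char_poly (normalized_laplacian R G)) in
  let c := num_components G in
  [/\ (num_strong_nodal G f <= k + r - 1)%N,
      (num_weak_nodal G f <= k + c - 1)%N
    & hconnected G -> (num_weak_nodal G f <= k)%N].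
Proof.
move=> r c; pose s := [seq lam i | i <- index_iota 1 n.+1].
have charL : char_poly (normalized_laplacian R G) = \prod_(x <- s) ('X - x%:P).
  by rewrite big_map.
have k_range : (1 <= k <= n)%N by rewrite k_ge1.
have below_le := count_lt_nth lam_nondecreasing k_range.
have r_eq : r = count_mem (lam k) s by rewrite /r charL mu_prod_XsubC.
have below_add m : (k.-1 + m = k + m - 1)%N by lia.
have strong_le : (num_strong_nodal G f <= k + r - 1)%N.
  rewrite -below_add r_eq.
  apply: leq_trans (num_strong_nodal_le deg_gt0 charL f_eigen) _.
  by rewrite leq_add2r.
have weak_le : (num_weak_nodal G f <= k + c - 1)%N.
  rewrite -below_add; apply: leq_trans (num_weak_nodal_le deg_gt0 charL f_eigen) _.
  by rewrite leq_add2r.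
split=> // /num_components_connected c_le1; apply: leq_trans weak_le _.
by rewrite /c; lia.
Qed.
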